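(* Let $\mathcal{S}$ be a commutative monoid, and let $a\in\mathrm{U}(\mathcal{S})\setminus\{0_{\mathcal{S}}\}$. If $\mathrm{U}(\mathcal{S})$ is infinite, then $\mathrm{D}_a(\mathcal{S})$ is infinite. If $\mathrm{U}(\mathcal{S})$ is finite, then $\mathrm{D}_a(\mathcal{S})$ is finite and $$\tfrac12\,\mathrm{D}(\mathrm{U}(\mathcal{S}))\ \leq\ \mathrm{D}_a(\mathcal{S})\ \leq\ \mathrm{D}(\mathrm{U}(\mathcal{S}))-1.$$
   Context: The commutative monoid $\mathcal{S}$ is written additively with identity $0_{\mathcal{S}}$; its group of units is $\mathrm{U}(\mathcal{S})=\{a\in\mathcal{S}: a+a'=0_{\mathcal{S}}\text{ for some }a'\in\mathcal{S}\}$. A sequence over $\mathcal{S}$ is a finite multiset $T$ of elements of $\mathcal{S}$, $|T|$ is its length (number of terms with multiplicity), and $\sigma(T)$ is the sum of its terms; the empty sequence has sum $0_{\mathcal{S}}$. $T$ is reducible if it has a proper (possibly empty) subsequence $T'\neq T$ with $\sigma(T')=\sigma(T)$, and irreducible otherwise. For $a\neq 0_{\mathcal{S}}$, $\mathrm{D}_a(\mathcal{S})\in\mathbb{N}\cup\{\infty\}$ is the largest length (supremum of lengths) of irreducible sequences $T$ over $\mathcal{S}$ with $\sigma(T)=a$. For an abelian group $G$, $\mathrm{D}(G)$ is the Davenport constant: the smallest $\ell\in\mathbb{N}\cup\{\infty\}$, with $\mathbb{N}=\{1,2,\dots\}$, such that every sequence over $G$ of length at least $\ell$ has a nonempty subsequence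 with sum $0_G$ (equivalently, is reducible). *)

(* Defs.v *)
From HB Require Import structures.
From mathcomp Require Import all_boot all_order all_algebra.
From mathcomp Require Import finmap multiset.
From mathcomp Require Import all_classical all_reals all_analysis.

Set Implicit Arguments.
Unset Strict Implicit.
Unset Printing Implicit Defensive.

Import Order.TTheory GRing.Theory Num.Theory.

Local Open Scope mset_scope.
Local Open Scope classical_set_scope.
Local Open Scope ring_scope.

Definition units (S : nmodType) : {pred S} :=
  fun a => `[< exists a' : S, a + a' = 0 >].
Arguments units : clear implicits.

Lemma unitsP (S : nmodType) (a : S) :
  reflect (exists a' : S, a + a' = 0) (a \in units S).
Proof. exact: asboolP. Qed.

Lemma units_add_closed (S : nmodType) : GRing.nmod_closed (units S).
Proof.
split; first by apply/unitsP; exists 0; rewrite addr0.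
move=> a b /unitsP[a' aa'] /unitsP[b' bb']; apply/unitsP.
by exists (a' + b'); rewrite addrACA aa' bb' addr0.
Qed.

(* The carrier of the group of units; its addition is inherited from S. *)
Record unit_group (S : nmodType) :=
  UnitGroup { unit_val :> S; unit_valP : units S unit_val }.

HB.instance Definition _ (S : nmodType) := [isSub for @unit_val S].
HB.instance Definition _ (S : nmodType) := [Choice of unit_group S by <:].
HB.instance Definition _ (S : nmodType) :=
  GRing.SubChoice_isSubNmodule.Build S (units S) (unit_group S)
    (units_add_closed S).

Lemma unit_group_has_opp (S : nmodType) (u : unit_group S) :
  exists v : unit_group S, u + v = 0.
Proof.
have /unitsP[a' ua'] := unit_valP u.
have Ha' : a' \in units S by apply/unitsP; exists (unit_val u); rewrite addrC.
by exists (UnitGroup Ha'); apply: val_inj; rewrite raddfD raddf0.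
Qed.

Definition unit_group_opp (S : nmodType) (u : unit_group S) : unit_group S :=
  xget 0 [set v | u + v = 0].

Lemma unit_group_addNr (S : nmodType) :
  left_inverse 0 (@unit_group_opp S) +%R.
Proof.
move=> u; rewrite addrC /unit_group_opp.
by case: xgetP => [_ -> //|nov]; have [v /nov] := unit_group_has_opp u.
Qed.

HB.instance Definition _ (S : nmodType) :=
  GRing.Nmodule_isZmodule.Build (unit_group S) (@unit_group_addNr S).

(* Sequences are finite multisets: [size T] counts terms with multiplicity. *)
Definition mset_sum (S : nmodType) (T : {mset S}) : S := \sum_(x <- T) x.

Definition reducible (S : nmodType) (T : {mset S}) : Prop :=
  exists2 T' : {mset S}, (T' `<` T)%mset & mset_sum T' = mset_sum T.

Definition irreducible (S : nmodType) (T : {mset S}) : Prop := ~ reducible T.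

(* Elements of N u {oo} are seen inside the extended reals over R. The value of
   [davenport_at] is meaningful for a != 0; in [davenport] the infimum is a
   minimum when some l qualifies, and +oo otherwise. *)
Definition davenport_at (R : realType) (S : nmodType) (a : S) : \bar R :=
  ereal_sup [set ((size T)%:R)%:E | T in
    [set T : {mset S} | irreducible T /\ mset_sum T = a]].

Definition davenport (R : realType) (G : zmodType) : \bar R :=
  ereal_inf [set (l%:R)%:E | l in
    [set l : nat | (0 < l)%N /\
      forall T : {mset G}, (l <= size T)%N ->
        exists T' : {mset G},
          [/\ (T' `<=` T)%mset, T' != mset0 & mset_sum T' = 0]]].

(* Main.v *)
(** An irreducible sequence whose sum is a unit consists of units, and is the
    same thing as a zero-sum free sequence over the group G of units.

    If G is infinite, any term t of a zero-sum free sequence can be split as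
    g + (t - g), keeping the sum and zero-sum freeness, as soon as g avoids
    finitely many values; starting from (a), this gives all lengths.

    If G is finite, a zero-sum free sequence T of the maximal length D(G) - 1
    with sum s has a subsequence A with sum a, since (- a) T is no longer
    zero-sum free. Replacing A in T by s and negating the remaining terms gives
    another sequence s (- (T \ A)) with sum a. It is zero-sum free too: if s were
    the sum of a subsequence C of T \ A, then T \ C would have sum 0. The lengths
    of these two sequences add up to D(G). *)

Require Import Defs.
From mathcomp Require Import all_boot all_order all_algebra.
From mathcomp Require Import finmap multiset.
From mathcomp Require Import all_classical all_reals all_analysis.
From mathcomp Require Import zify lra.

Import Order.TTheory GRing.Theory Num.Theory.

Local Open Scope mset_scope.
Local Open Scope classical_set_scope.
Local Open Scope ring_scope.

(** * Finite multisets: subsequences, images and sums *)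

Section Multisets.
Set Implicit Arguments.
Unset Strict Implicit.

Lemma perm_msetD (K : choiceType) (A B : {mset K}) :
  perm_eq (A `+` B)%mset ((A : seq K) ++ B).
Proof.
by apply/allP => x _ /=; rewrite count_cat !count_mem_mset msetE2.
Qed.

Lemma size_msetD (K : choiceType) (A B : {mset K}) :
  size (A `+` B)%mset = (size A + size B)%N.
Proof. by rewrite (perm_size (perm_msetD A B)) size_cat. Qed.

Lemma size_mset1 (K : choiceType) (x : K) : size [mset x]%mset = 1%N.
Proof. by rewrite enum_msetn. Qed.

Lemma size_mset_eq0 (K : choiceType) (A : {mset K}) :
  size A = 0%N -> A = mset0.
Proof.
by move/size0nil => A0; rewrite -(seq_mset_id A) A0 -enum_mset0 seq_mset_id.
Qed.

(** Masks of a fixed length form a finite type, whence a sequence has only finitely many subsums. *)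
Lemma msubset_perm_mask (K : choiceType) (A B : {mset K}) :
  (B `<=` A)%mset ->
  exists m : (size A).-tuple bool, perm_eq B (mask m A).
Proof.
move=> /msubsetP BA.
have /count_subseqP[s /subseqP[m sm ->] Bs] :
    forall x, (count_mem x B <= count_mem x A)%N.
  by move=> x; rewrite !count_mem_mset.
by exists (tcast sm (in_tuple m)); rewrite val_tcast.
Qed.

Lemma msubset_mset1D (K : choiceType) (x : K) (A B : {mset K}) :
  (B `<=` x +` A)%mset ->
  (B `<=` A)%mset \/ exists2 C, (C `<=` A)%mset & B = (x +` C)%mset.
Proof.
move=> /msubsetP BxA; have [xB|xB] := boolP (x \in B); [right|left].
  exists (B `\ x)%mset; last by rewrite msetB1K.
  by apply/msubsetP => y; have := BxA y; rewrite msetB1E mset1DE; lia.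
apply/msubsetP => y; have := BxA y; rewrite mset1DE.
by have [->|] := eqVneq y x; [rewrite (mset_eq0P xB) | lia].
Qed.

Lemma msubset_msetB_swap (K : choiceType) (A B C : {mset K}) :
  (A `<=` C)%mset -> (B `<=` C `\` A)%mset -> (A `<=` C `\` B)%mset.
Proof.
move=> /msubsetP AC /msubsetP BCA; apply/msubsetP => x.
by have := AC x; have := BCA x; rewrite !msetE2; lia.
Qed.

Definition mset_map (K L : choiceType) (f : K -> L) (A : {mset K}) : {mset L} :=
  seq_mset (map f A).

Lemma perm_mset_map (K L : choiceType) (f : K -> L) (A : {mset K}) :
  perm_eq (mset_map f A) (map f A).
Proof. exact: perm_eq_seq_mset. Qed.

Lemma size_mset_map (K L : choiceType) (f : K -> L) (A : {mset K}) :
  size (mset_map f A) = size A.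
Proof. by rewrite (perm_size (perm_mset_map f A)) size_map. Qed.

Lemma mset_map0 (K L : choiceType) (f : K -> L) : mset_map f mset0 = mset0.
Proof. by apply: size_mset_eq0; rewrite size_mset_map enum_mset0. Qed.

Lemma msubset_mset_map (K L : choiceType) (f : K -> L) (A B : {mset K}) :
  (A `<=` B)%mset -> (mset_map f A `<=` mset_map f B)%mset.
Proof.
move=> AB; apply/msubsetP => y; rewrite !mset_seqE -(msetBDKC AB).
by rewrite (permP (perm_map f (perm_msetD _ _))) map_cat count_cat leq_addr.
Qed.

(** A subsequence of [map f A] is cut out by a mask, and the same mask applied to [A] gives [C]. *)
Lemma msubset_mset_mapP (K L : choiceType) (f : K -> L) (A : {mset K})
    (B : {mset L}) :
  (B `<=` mset_map f A)%mset ->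
  exists2 C, (C `<=` A)%mset & B = mset_map f C.
Proof.
move=> /msubset_perm_mask[m Bm].
have /count_subseqP[s /subseqP[p _ ->] Bs] :
    forall y, (count_mem y B <= count_mem y (map f A))%N.
  move=> y; rewrite (permP Bm) -(permP (perm_mset_map f A)).
  exact/leq_count_subseq/mask_subseq.
exists (seq_mset (mask p A)).
  apply/msubsetP => x; rewrite mset_seqE -count_mem_mset.
  exact/leq_count_subseq/mask_subseq.
rewrite -(seq_mset_id B); apply/eq_seq_msetP/(perm_trans Bs).
by rewrite -map_mask perm_map// perm_sym perm_eq_seq_mset.
Qed.

Lemma mset_sum_perm (S : nmodType) (T : {mset S}) (s : seq S) :
  perm_eq T s -> mset_sum T = \sum_(x <- s) x.
Proof. exact: perm_big. Qed.

Lemma mset_sum0 (S : nmodType) : mset_sum (mset0 : {mset S}) = 0.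
Proof. by rewrite /mset_sum enum_mset0 big_nil. Qed.

Lemma mset_sum1 (S : nmodType) (x : S) : mset_sum [mset x]%mset = x.
Proof. by rewrite /mset_sum enum_msetn big_seq1. Qed.

Lemma mset_sumD (S : nmodType) (A B : {mset S}) :
  mset_sum (A `+` B)%mset = mset_sum A + mset_sum B.
Proof. by rewrite (mset_sum_perm (perm_msetD A B)) big_cat. Qed.

Lemma mset_sumB (S : zmodType) (A B : {mset S}) :
  (B `<=` A)%mset -> mset_sum (A `\` B)%mset = mset_sum A - mset_sum B.
Proof. by move=> /msetBDK {2}<-; rewrite mset_sumD addrK. Qed.

Lemma mset_sum_map (S S' : nmodType) (f : {additive S -> S'}) (T : {mset S}) :
  mset_sum (mset_map f T) = f (mset_sum T).
Proof. by rewrite (mset_sum_perm (perm_mset_map f T)) big_map raddf_sum. Qed.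

Lemma subset_sums_finite (S : nmodType) (T : {mset S}) :
  exists s : seq S, forall A, (A `<=` T)%mset -> mset_sum A \in s.
Proof.
exists [seq \sum_(x <- mask m T) x | m : (size T).-tuple bool] => A.
move=> /msubset_perm_mask[m /mset_sum_perm ->].
by apply/fintype.imageP; exists m.
Qed.

End Multisets.

(** * Zero-sum free sequences over an abelian group *)

Section ZeroSumFree.
Set Implicit Arguments.
Unset Strict Implicit.

(** In a group this amounts to irreducibility: a proper subsequence has the full sum exactly when
    its nonempty complement has sum 0. *)
Definition zero_sum_free (G : zmodType) (T : {mset G}) : Prop :=
  forall A, (A `<=` T)%mset -> mset_sum A = 0 -> A = mset0.

Lemma zero_sum_free0 (G : zmodType) : zero_sum_free (mset0 : {mset G}).
Proof. by move=> A; rewrite msubset0 => /eqP. Qed.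

Lemma zero_sum_free_sub (G : zmodType) (A T : {mset G}) :
  (A `<=` T)%mset -> zero_sum_free T -> zero_sum_free A.
Proof. by move=> AT Tfree B /msubset_trans/(_ AT); exact: Tfree. Qed.

Lemma zero_sum_free_mset1D (G : zmodType) (g : G) (T : {mset G}) :
  zero_sum_free T ->
  (forall A, (A `<=` T)%mset -> g + mset_sum A != 0) ->
  zero_sum_free (g +` T)%mset.
Proof.
move=> Tfree gT B /msubset_mset1D[/Tfree//|[C CT ->]].
by rewrite mset_sumD mset_sum1 => /eqP; rewrite (negPf (gT _ CT)).
Qed.

Lemma zero_sum_free_mset1 (G : zmodType) (a : G) :
  a != 0 -> zero_sum_free [mset a]%mset.
Proof.
move=> a0; rewrite -(msetD0 [mset a]%mset).
apply: zero_sum_free_mset1D; first exact: zero_sum_free0.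
by move=> A; rewrite msubset0 => /eqP ->; rewrite mset_sum0 addr0.
Qed.

Lemma zero_sum_free_opp (G : zmodType) (T : {mset G}) :
  zero_sum_free T -> zero_sum_free (mset_map -%R T).
Proof.
move=> Tfree _ /msubset_mset_mapP[C CT ->].
rewrite mset_sum_map => /eqP; rewrite oppr_eq0 => /eqP /(Tfree _ CT) ->.
exact: mset_map0.
Qed.

(** * Infinite groups: arbitrarily long sequences *)

Lemma zero_sum_free_split (G : zmodType) (t : G) (T : {mset G}) :
  infinite_set [set: G] -> zero_sum_free (t +` T)%mset ->
  exists g, zero_sum_free (g +` ((t - g) +` T))%mset.
Proof.
move=> Ginf tTfree; have [s sP] := subset_sums_finite T.
(* The first list rules out zero sums using the new term [g] without [t - g], the second those using
   [t - g] without [g]. *)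
have [g] : exists g, g \notin map -%R s ++ map (+%R t) s.
  apply: contra_notP Ginf => /forallNP sG.
  apply/finite_seqP; exists (map -%R s ++ map (+%R t) s).
  by apply/seteqP; split => // x _ /=; have /negP := sG x; rewrite negbK.
rewrite mem_cat negb_or => /andP[gNs gts].
have Tfree : zero_sum_free T.
  apply: zero_sum_free_sub tTfree.
  by apply/msubsetP => x; rewrite mset1DE leq_addl.
exists g; apply: zero_sum_free_mset1D.
  apply: zero_sum_free_mset1D => // A AT.
  apply: contra gts => /eqP e; apply/mapP; exists (mset_sum A); first exact: sP.
  by apply/eqP; rewrite eq_sym -subr_eq0 addrAC e.
move=> A /msubset_mset1D[AT|[C CT ->]].
  apply: contra gNs; rewrite addr_eq0 => /eqP ->; apply: map_f; exact: sP.
(* The terms [g] and [t - g] together contribute [t], so a zero sum here would already occur in the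
   original sequence, as that of [t] and [C]. *)
rewrite mset_sumD mset_sum1 addrA addrCA subrr addr0.
apply/eqP => e; have tC0 : (t +` C)%mset = mset0.
  apply: tTfree; last by rewrite mset_sumD mset_sum1.
  by apply/msubsetP => x; rewrite !mset1DE leq_add2l; move/msubsetP: CT.
by have := mset1D1 t C; rewrite tC0 in_mset0.
Qed.

Lemma long_zero_sum_free (G : zmodType) (a : G) (n : nat) :
  infinite_set [set: G] -> a != 0 ->
  exists T : {mset G}, [/\ zero_sum_free T, mset_sum T = a & size T = n.+1].
Proof.
move=> Ginf a0; elim: n => [|n [T [Tfree Ta Tn]]].
  exists [mset a]%mset.
  by split; [exact: zero_sum_free_mset1 | exact: mset_sum1 | exact: size_mset1].
have [t tT] : exists t, t \in T.
  have : has predT T by rewrite has_predT Tn.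
  by case/hasP => t tT _; exists t.
move: Tfree Ta Tn.
rewrite -(msetB1K tT) mset_sumD size_msetD mset_sum1 size_mset1.
move=> /(zero_sum_free_split Ginf)[g gfree] Ta Tn.
exists (g +` ((t - g) +` (T `\ t)))%mset.
split=> //; first by rewrite !mset_sumD !mset_sum1 addrA addrCA subrr addr0.
by rewrite !size_msetD !size_mset1 Tn.
Qed.

(** * Finite groups: the Davenport constant *)

(** Pigeonhole: the partial sums of [T], the empty one included, are [size T + 1] distinct elements
    of the list [s]. *)
Lemma zero_sum_free_size_lt (G : zmodType) (s : seq G) (T : {mset G}) :
  [set: G] `<=` [set` s] -> zero_sum_free T -> (size T < size s)%N.
Proof.
move=> sG Tfree.
pose p i := \sum_(x <- take i T) x.
have p_inj : {in iota 0 (size T).+1 &, injective p}.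
  suff p_lt i j : (i < j <= size T)%N -> p i <> p j.
    move=> i j; rewrite !mem_iota !add0n !ltnS /= => iT jT pij.
    have [ij|ji|//] := ltngtP i j.
      by case: (p_lt i j); rewrite // ij.
    by case: (p_lt j i); rewrite // ji.
  (* Equal partial sums force the block [B] of terms between them to have sum 0, hence to be empty,
     against [i < j]. *)
  move=> /andP[ij jT] pij; pose B := seq_mset (drop i (take j T)).
  have B0 : B = mset0.
    apply: Tfree.
      apply/msubsetP => x; rewrite mset_seqE -count_mem_mset.
      apply: leq_count_subseq; apply: (subseq_trans (drop_subseq _ _)).
      exact: take_subseq.
    rewrite (mset_sum_perm (perm_eq_seq_mset _)).
    apply: (@addrI _ (p i)); rewrite addr0 [RHS]pij /p.
    rewrite -[in RHS](cat_take_drop i (take j T)) big_cat /=.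
    by rewrite take_takel 1?ltnW.
  have := perm_size (perm_eq_seq_mset (drop i (take j T))).
  by rewrite -/B B0 enum_mset0 size_drop size_takel//=; lia.
rewrite -(size_iota 0 (size T).+1) -(size_map p); apply: uniq_leq_size.
  by rewrite map_inj_in_uniq// iota_uniq.
by move=> x _; exact: sG.
Qed.

(** The infimum is a minimum because the length of a list of all elements of [G] is admissible. *)
Lemma davenport_finite (R : realType) (G : zmodType) :
  finite_set [set: G] ->
  exists D : nat, [/\ davenport R G = (D%:R)%:E,
    forall T : {mset G}, zero_sum_free T -> (size T < D)%N &
    exists2 T : {mset G}, zero_sum_free T & (size T).+1 = D].
Proof.
move=> /finite_seqP[s sG].
pose bound n := `[< forall T : {mset G}, zero_sum_free T -> (size T < n)%N >].
(* [bound] is the contrapositive of the property defining [davenport]; positivity comes from the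
   empty sequence. *)
have boundP n : bound n <-> (0 < n)%N /\
    forall T : {mset G}, (n <= size T)%N ->
      exists T' : {mset G},
        [/\ (T' `<=` T)%mset, T' != mset0 & mset_sum T' = 0].
  split=> [/asboolP Tn|[n0 Tn]].
    split; first by have := Tn _ (@zero_sum_free0 G); rewrite enum_mset0.
    move=> T nT; apply: contrapT => noT'; suff /Tn : zero_sum_free T by lia.
    move=> A AT A0; apply/eqP/negPn/negP => An0; apply: noT'; by exists A.
  apply/asboolP => T Tfree; rewrite ltnNge; apply/negP => /Tn[A [AT An0 A0]].
  by rewrite (Tfree A AT A0) eqxx in An0.
have ex_bound : exists n, bound n.
  exists (size s); apply/asboolP => T; apply: zero_sum_free_size_lt.
  by rewrite sG.
case: (ex_minnP ex_bound) => D /[dup] /asboolP DT Dbound Dmin.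
exists D; split => //.
  apply/eqP; rewrite eq_le; apply/andP; split.
    by apply: ereal_inf_lbound; exists D => //; apply/boundP.
  apply: le_ereal_inf_tmp => _ [n /boundP/Dmin Dn <-].
  by rewrite lee_fin ler_nat.
(* Without a zero-sum free sequence of length [D - 1], the bound would drop to [D.-1], which is
   smaller since [D] is positive. *)
apply: contrapT => noT; suff /Dmin : bound D.-1.
  by have := DT _ (@zero_sum_free0 G); lia.
apply/asboolP => T Tfree; have := DT _ Tfree.
have [TD|] := eqVneq (size T).+1 D; last by lia.
by case: noT; exists T.
Qed.

(** * Reflection: a sequence of more than half the maximal length *)

(** Otherwise appending [- a] would give a longer zero-sum free sequence. *)
Lemma maximal_zero_sum_free_subsum (G : zmodType) (T : {mset G}) (a : G) :
  zero_sum_free T ->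
  (forall T' : {mset G}, zero_sum_free T' -> (size T' <= size T)%N) ->
  a != 0 -> exists2 A, (A `<=` T)%mset & mset_sum A = a.
Proof.
move=> Tfree Tmax a0; apply: contrapT => noA.
have /Tmax : zero_sum_free (- a +` T)%mset.
  apply: zero_sum_free_mset1D => // A AT.
  by rewrite addrC subr_eq0; apply/eqP => Aa; apply: noA; exists A.
by rewrite size_msetD size_mset1 ltnn.
Qed.

(** A subsum using the term [mset_sum T] and the negatives of [C] is the sum of [T] without [C],
    which contains the nonempty [A]. *)
Lemma zero_sum_free_reflect (G : zmodType) (A T : {mset G}) :
  zero_sum_free T -> (A `<=` T)%mset -> A != mset0 ->
  zero_sum_free (mset_sum T +` mset_map -%R (T `\` A))%mset.
Proof.
move=> Tfree AT An0; apply: zero_sum_free_mset1D.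
  apply: zero_sum_free_opp; apply: zero_sum_free_sub Tfree; exact: msubsetDl.
move=> _ /msubset_mset_mapP[C CTA ->]; rewrite mset_sum_map.
have CT : (C `<=` T)%mset by apply: msubset_trans CTA _; exact: msubsetDl.
rewrite -mset_sumB//; apply/eqP => /Tfree TC0.
have := msubset_msetB_swap AT CTA.
by rewrite TC0 ?msubsetDl// msubset0 (negPf An0).
Qed.

Lemma half_length_zero_sum_free (G : zmodType) (T : {mset G}) (a : G) :
  zero_sum_free T ->
  (forall T' : {mset G}, zero_sum_free T' -> (size T' <= size T)%N) ->
  a != 0 -> exists T' : {mset G},
    [/\ zero_sum_free T', mset_sum T' = a & (size T < (size T').*2)%N].
Proof.
move=> Tfree Tmax a0.
have [A AT Aa] := maximal_zero_sum_free_subsum Tfree Tmax a0.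
have sT : (size A + size (T `\` A)%mset)%N = size T.
  by rewrite -size_msetD msetBDKC.
(* The two candidates have lengths [size A] and [size T - size A + 1], adding up to [size T + 1], so
   one of them is long enough. *)
have [hA|hA] := ltnP (size T) (size A).*2.
  by exists A; split => //; exact: zero_sum_free_sub Tfree.
exists (mset_sum T +` mset_map -%R (T `\` A))%mset; split.
- apply: zero_sum_free_reflect => //.
  by apply: contraNneq a0 => A0; rewrite -Aa A0 mset_sum0.
- by rewrite mset_sumD mset_sum1 mset_sum_map mset_sumB//= opprB addrC subrK.
- by rewrite size_msetD size_mset1 (@size_mset_map G G); lia.
Qed.

(** * From the monoid to its group of units *)

(** Each term of [T] is inverted by the sum of the other terms plus an inverse of the whole sum. *)
Lemma unit_sum_mset_map (S : nmodType) (T : {mset S}) :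
  mset_sum T \in units S ->
  exists U : {mset unit_group S}, T = mset_map val U.
Proof.
move=> /unitsP[b Tb].
have Tunits : all (units S) T.
  apply/allP => x xT; apply/unitsP; exists (mset_sum (T `\ x)%mset + b).
  by rewrite addrA -{1}(mset_sum1 x) -mset_sumD msetB1K.
exists (seq_mset (pmap insub T)).
rewrite -(seq_mset_id T) /mset_map; apply/eq_seq_msetP.
rewrite (permPr (perm_map _ (perm_eq_seq_mset _))).
by rewrite (pmap_filter (@insubK _ _ _)) seq_mset_id (eq_filter (isSome_insub _))
  (all_filterP Tunits).
Qed.

Lemma irreducible_unit (S : nmodType) (U : {mset unit_group S}) :
  irreducible (mset_map val U) <-> zero_sum_free U.
Proof.
split=> [Uirr A AU A0|Ufree [_ /[dup] /mproper_sub /msubset_mset_mapP[C CU ->]]].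
  apply/eqP/negPn/negP => An0; apply: Uirr.
  exists (mset_map val (U `\` A)%mset); last first.
    by rewrite !mset_sum_map mset_sumB// A0 subr0.
  rewrite mproperEneq msubset_mset_map ?msubsetDl// andbT.
  (* Were the two images equal, counting terms would give [A] length 0. *)
  apply: contraNneq An0 => /(congr1 (fun B : {mset S} => size B)).
  rewrite !size_mset_map -[in RHS](msetBDKC AU) size_msetD -[LHS]add0n.
  by move=> /addIn/esym/size_mset_eq0 ->.
move=> CprU; rewrite !mset_sum_map => /val_inj CU0.
have : (U `\` C)%mset = mset0.
  by apply: Ufree; rewrite ?msubsetDl// mset_sumB// CU0 subrr.
move/eqP; rewrite msetB_eq0 => /(msubset_mset_map val) UC.
by move: CprU; rewrite mproperE UC andbF.
Qed.

Lemma davenport_at_unit (R : realType) (S : nmodType) (u : unit_group S) :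
  davenport_at R (val u) =
  ereal_sup [set ((size U)%:R)%:E | U in
    [set U : {mset unit_group S} | zero_sum_free U /\ mset_sum U = u]].
Proof.
congr ereal_sup; apply/seteqP; split => _ [T [Tfree Tu] <-].
  have [|U TU] := @unit_sum_mset_map _ T; first by rewrite Tu; exact: (valP u).
  move: Tfree Tu; rewrite TU mset_sum_map => /irreducible_unit Ufree /val_inj Uu.
  by exists U => //; rewrite size_mset_map.
exists (mset_map val T); last by rewrite size_mset_map.
by split; [exact/irreducible_unit | rewrite mset_sum_map Tu].
Qed.
End ZeroSumFree.

(** * The bounds for a nonzero unit *)

Local Open Scope ereal_scope.

Theorem corollary1p5 (R : realType) (S : nmodType) (a : S)
    (a_unit : a \in units S) (a_neq0 : a != 0%R) :
  (infinite_set [set: unit_group S] -> davenport_at R a = +oo) /\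
  (finite_set [set: unit_group S] ->
     davenport_at R a \is a fin_num /\
     (2^-1)%:E * davenport R (unit_group S) <= davenport_at R a
       <= davenport R (unit_group S) - 1).
Proof.
pose u : unit_group S := UnitGroup a_unit.
have u_neq0 : u != 0%R by apply: contraNneq a_neq0 => u0; rewrite -[a]/(val u) u0.
rewrite -[a]/(val u) davenport_at_unit; split => [Ginf|Gfin].
  (* With this [n], the length [n + 1] exceeds the arbitrary real [r]. *)
  apply: eq_infty => r; pose n := Num.truncn r.
  have [T [Tfree Tu Tn]] := long_zero_sum_free n Ginf u_neq0.
  apply: (@le_trans _ _ (n.+1%:R)%:E); first by rewrite lee_fin ltW// truncnS_gt.
  by apply: ereal_sup_ubound; exists T; rewrite ?Tn.
have [D [-> Dbound [T Tfree TD]]] := davenport_finite R Gfin.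
have Tmax (T' : {mset unit_group S}) : zero_sum_free T' -> (size T' <= size T)%N.
  by move=> /Dbound; rewrite -TD ltnS.
have [T' [T'free T'u T'size]] := half_length_zero_sum_free Tfree Tmax u_neq0.
set d := ereal_sup _.
have dle : d <= (D%:R)%:E - 1.
  apply: ge_ereal_sup => _ [U [Ufree _] <-].
  by rewrite -EFinB lee_fin -TD -natr1 addrK ler_nat Tmax.
have led : (2^-1)%:E * (D%:R)%:E <= d.
  apply: (@le_trans _ _ ((size T')%:R)%:E); last by apply: ereal_sup_ubound; exists T'.
  (* As [size T] is [D - 1], the strict inequality [T'size] yields [D] itself as a lower bound. *)
  have : (D%:R <= (size T').*2%:R :> R)%R by rewrite ler_nat -TD.
  by rewrite -EFinM lee_fin -muln2 natrM; lra.
split; last by rewrite led dle.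
(* Lying between two finite values, [d] is finite. *)
rewrite fin_numElt (lt_le_trans _ led) ?ltNyr//=.
by rewrite (le_lt_trans dle)// -EFinB ltry.
Qed.
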